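(* The family $E_{3a}=E_{3a}(e_1,e_2,e_5,e_6)$ admits a shift operator for each of the shifts $e_i\to e_i\pm1$ ($i=1,2$) and $e_j\to e_j\pm2$ ($j=5,6$), where in each case the other three of the free parameters $e_1,e_2,e_5,e_6$ are kept fixed.
   Context: Let $\partial=d/dx$ and $D=\mathbb{C}(x)[\partial]$. The operator $E_3(e)$: for $e=(e_1,\dots,e_7)$ with $e_1+\cdots+e_7=3$, put $$E_3(e)=x^2(x-1)^2\partial^3+x(x-1)(a_{21}x+a_{20})\partial^2+(a_{12}x^2+a_{11}x+a_{10})\partial+a_{01}x+A_{00}(e),$$ where $a_{21}=6-e_1-e_2-e_3-e_4$, $a_{20}=-3+e_1+e_2$, $a_{12}=(e_5+e_6+1)e_7+(e_6+1)(e_5+1)$, $a_{11}=-(e_5+e_6)e_7-e_1e_2+e_3e_4-e_5e_6+2e_1+2e_2-4$, $a_{10}=(e_1-1)(e_2-1)$, $a_{01}=e_5e_6e_7$, and $$\begin{aligned}54A_{00}(e)=&-4(e_1+e_2-e_3-e_4)^3-27e_5e_6e_7+9(e_1+e_2-e_3-e_4)(e_5e_6+e_5e_7+e_6e_7-2)\\&+9e_1e_2(e_1+e_2-1)+18(e_1+e_2-1)(e_3^2+e_3e_4+e_4^2)\\&-9e_3e_4(e_3+e_4-1)-18(e_3+e_4-1)(e_1^2+e_1e_2+e_2^2).\end{aligned}$$ $E_{3a}(e_1,e_2,e_5,e_6)$ is the specialization of $E_3(e)$ by $e_3=e_1$, $e_4=e_2$ (so $e_7=3-2e_1-2e_2-e_5-e_6$).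 Shift operators: let $E(p)$ be a family of third-order operators depending on parameters $p$, irreducible for generic $p$, and let $p\to p_+$ be a shift of the parameters by integers. A shift operator for this shift is a non-zero operator $P\in D$ of order lower than $3$, depending on $p$, sending the solution space of $E(p)$ to the solution space of $E(p_+)$; equivalently, there is $Q\in D$ with $E(p_+)\circ P=Q\circ E(p)$. The parameters are regarded as generic (indeterminates); the coefficients of $P$ are rational functions of $x$ and of $p$ (poles in $x$ are allowed; after normalization they may be taken polynomial in $p$ without common factor). *)

(* Defs.v *)
From HB Require Import structures.
From mathcomp Require Import all_boot all_order all_algebra.
From mathcomp Require Import reals complex mpoly ring.
Set Implicit Arguments.
Unset Strict Implicit.
Unset Printing Implicit Defensive.
Import GRing.Theory.
Local Open Scope ring_scope.
Local Open Scope quotient_scope.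

Notation "x %:F" := (@FracField.tofrac _ x) : ring_scope.

Section DifferentialOperators.
Variable K : fieldType.

Definition ratfun := {fraction {poly K}}.

(* d/dx on K(x), the elements of K being constants; the value does not depend
   on the representative n/d (fderiv_frac). *)
Definition fderiv (f : ratfun) : ratfun :=
  let n := \n_(repr f) in let d := \d_(repr f) in
  (n^`() * d - n * d^`())%:F / (d ^+ 2)%:F.

(* K(x)[d/dx]: the polynomial \sum_i a_i 'X^i stands for the operator
   \sum_i a_i (d/dx)^i, coefficients on the left.  The commutative product of
   {poly ratfun} is not the product of operators, which is dcomp below. *)
Definition diffop := {poly ratfun}.

Definition partial : diffop := 'X.

(* (d/dx) o Q, from the commutation rule (d/dx) o a = a (d/dx) + a'. *)
Definition dleft (Q : diffop) : diffop :=
  Q * partial + map_poly fderiv Q.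

Definition dcomp (P Q : diffop) : diffop :=
  \sum_(i < size P) P`_i *: iter i dleft Q.

Definition dapply (P : diffop) (f : ratfun) : ratfun :=
  \sum_(i < size P) P`_i * iter i fderiv f.

Definition shift_operator (E Eplus P : diffop) : Prop :=
  [/\ P != 0, (size P <= 3)%N & exists Q : diffop, dcomp Eplus P = dcomp Q E].

Definition has_shift_operator (E Eplus : diffop) : Prop :=
  exists P : diffop, shift_operator E Eplus P.

Lemma ratfunE (f : ratfun) : f = (\n_(repr f))%:F / (\d_(repr f))%:F.
Proof.
have dn0 : (\d_(repr f))%:F != 0 :> ratfun.
  by rewrite tofrac_eq0 denom_ratioP.
apply: (mulIf dn0); rewrite mulfVK //.
rewrite -{1}[f]reprK (_ : GRing.mul = @FracField.mul _) // !piE.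
apply/eqmodP; rewrite /= FracField.equivfE /FracField.mulf.
by rewrite !numden_Ratio ?mulr1 ?mul1r ?oner_eq0 ?denom_ratioP // mulrC.
Qed.

Lemma fderiv_frac (n d : {poly K}) : d != 0 ->
  fderiv (n%:F / d%:F) = (n^`() * d - n * d^`())%:F / (d ^+ 2)%:F.
Proof.
move=> d0; rewrite /fderiv; set f : ratfun := n%:F / d%:F.
have := ratfunE f; have := denom_ratioP (repr f).
move: (\n_(repr f)) (\d_(repr f)) => a b b0 fE.
have F0 (u : {poly K}) : u != 0 -> u%:F != 0 :> ratfun by rewrite tofrac_eq0.
have e : n * b = a * d.
  apply/eqP; rewrite -tofrac_eq !tofracM; move/eqP: fE.
  by rewrite /f eqr_div ?F0.
have e' := congr1 (@deriv K) e; rewrite !derivM in e'.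
apply/eqP; rewrite eqr_div ?F0 ?expf_neq0 // -!tofracM tofrac_eq; apply/eqP.
have -> : (a^`() * b - a * b^`()) * d ^+ 2 =
  (n^`() * b + n * b^`()) * b * d - (n * b) * d^`() * b - (n * b) * b^`() * d.
  by rewrite e' e; ring.
ring.
Qed.

Lemma fderiv_tofrac (p : {poly K}) : fderiv p%:F = (p^`())%:F.
Proof.
rewrite -[p%:F]divr1 -tofrac1 fderiv_frac ?oner_eq0 //.
by rewrite -polyC1 derivC mulr0 subr0 mulr1 expr1n tofrac1 divr1.
Qed.

Lemma fderivD : {morph fderiv : f g / f + g}.
Proof.
move=> f g; rewrite (ratfunE f) (ratfunE g).
move: (denom_ratioP (repr f)) (denom_ratioP (repr g)).
move: (\n_(repr f)) (\d_(repr f)) (\n_(repr g)) (\d_(repr g)) => a b c d b0 d0.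
have F0 (u : {poly K}) : u != 0 -> u%:F != 0 :> ratfun by rewrite tofrac_eq0.
rewrite addf_div ?F0 // -!tofracM -tofracD !fderiv_frac ?mulf_neq0 //.
rewrite addf_div ?F0 ?expf_neq0 // -!tofracM -tofracD -exprMn.
by congr (_%:F / _); rewrite !derivE; ring.
Qed.

Lemma fderivM (f g : ratfun) : fderiv (f * g) = fderiv f * g + f * fderiv g.
Proof.
rewrite (ratfunE f) (ratfunE g).
move: (denom_ratioP (repr f)) (denom_ratioP (repr g)).
move: (\n_(repr f)) (\d_(repr f)) (\n_(repr g)) (\d_(repr g)) => a b c d b0 d0.
have F0 (u : {poly K}) : u != 0 -> u%:F != 0 :> ratfun by rewrite tofrac_eq0.
rewrite mulf_div -!tofracM !fderiv_frac ?mulf_neq0 // !mulf_div -!tofracM.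
rewrite addf_div ?F0 ?mulf_neq0 ?expf_neq0 // -!tofracM -tofracD.
apply/eqP; rewrite eqr_div ?F0 ?mulf_neq0 ?expf_neq0 ?mulf_neq0 //.
by rewrite -!tofracM tofrac_eq; apply/eqP; rewrite !derivM; ring.
Qed.

Lemma fderiv0 : fderiv 0 = 0.
Proof. by rewrite -tofrac0 fderiv_tofrac deriv0. Qed.

Lemma dapplyE n (P : diffop) f : (size P <= n)%N ->
  dapply P f = \sum_(i < n) P`_i * iter i fderiv f.
Proof.
move=> le; rewrite /dapply (big_ord_widen n (fun i => P`_i * iter i fderiv f)) //.
rewrite big_mkcond; apply: eq_bigr => i _.
by case: ltnP => // /(nth_default 0) ->; rewrite mul0r.
Qed.

Lemma dapplyD P Q f : dapply (P + Q) f = dapply P f + dapply Q f.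
Proof.
set n := maxn (size P) (size Q).
rewrite !(@dapplyE n) ?leq_maxl ?leq_maxr ?(leq_trans (size_polyD _ _)) //.
by rewrite -big_split; apply: eq_bigr => i _; rewrite coefD mulrDl.
Qed.

Lemma dapplyZ a P f : dapply (a *: P) f = a * dapply P f.
Proof.
rewrite !(@dapplyE (size P)) ?size_scale_leq // mulr_sumr.
by apply: eq_bigr => i _; rewrite coefZ mulrA.
Qed.

Lemma dapply_dleft Q f : dapply (dleft Q) f = fderiv (dapply Q f).
Proof.
rewrite /dleft dapplyD.
have sX : (size (Q * partial)%R <= (size Q).+1)%N.
  by rewrite (leq_trans (size_polyMleq _ _)) // size_polyX addn2.
rewrite (dapplyE _ sX) (@dapplyE (size Q)) ?size_poly // big_ord_recl.
rewrite coefMX mul0r add0r -big_split /dapply.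
rewrite (big_morph _ fderivD fderiv0); apply: eq_bigr => i _ /=.
by rewrite coefMX fderivM addrC /map_poly coef_poly ltn_ord.
Qed.

Lemma dapply_dcomp P Q f : dapply (dcomp P Q) f = dapply P (dapply Q f).
Proof.
have d0 : dapply 0 f = 0 by rewrite /dapply size_poly0 big_ord0.
rewrite /dcomp (big_morph (dapply^~ f) (fun A B => dapplyD A B f) d0).
apply: eq_bigr => i _; rewrite dapplyZ; congr (_ * _).
by elim: (i : nat) => //= j IH; rewrite dapply_dleft IH.
Qed.

End DifferentialOperators.

Arguments partial {K}.

Section Family.
Variable K : fieldType.
Implicit Types e : K.

Definition A00 e1 e2 e3 e4 e5 e6 e7 : K :=
  (- 4 * (e1 + e2 - e3 - e4) ^+ 3
   - 27 * e5 * e6 * e7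
   + 9 * (e1 + e2 - e3 - e4) * (e5 * e6 + e5 * e7 + e6 * e7 - 2)
   + 9 * e1 * e2 * (e1 + e2 - 1)
   + 18 * (e1 + e2 - 1) * (e3 ^+ 2 + e3 * e4 + e4 ^+ 2)
   - 9 * e3 * e4 * (e3 + e4 - 1)
   - 18 * (e3 + e4 - 1) * (e1 ^+ 2 + e1 * e2 + e2 ^+ 2)) / 54.

(* Meant for e1 + ... + e7 = 3. *)
Definition E3 e1 e2 e3 e4 e5 e6 e7 : diffop K :=
  let a21 := 6 - e1 - e2 - e3 - e4 in
  let a20 := - 3 + e1 + e2 in
  let a12 := (e5 + e6 + 1) * e7 + (e6 + 1) * (e5 + 1) in
  let a11 := - (e5 + e6) * e7 - e1 * e2 + e3 * e4 - e5 * e6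
             + 2 * e1 + 2 * e2 - 4 in
  let a10 := (e1 - 1) * (e2 - 1) in
  let a01 := e5 * e6 * e7 in
  let a00 := A00 e1 e2 e3 e4 e5 e6 e7 in
  let x : {poly K} := 'X in
    (x ^+ 2 * (x - 1) ^+ 2)%:F *: partial ^+ 3
  + (x * (x - 1) * (a21%:P * x + a20%:P))%:F *: partial ^+ 2
  + (a12%:P * x ^+ 2 + a11%:P * x + a10%:P)%:F *: partial
  + ((a01%:P * x + a00%:P)%:F)%:P.

Definition E3a e1 e2 e5 e6 : diffop K :=
  E3 e1 e2 e1 e2 e5 e6 (3 - 2 * e1 - 2 * e2 - e5 - e6).

End Family.

Section GenericPoint.
Variable R : realType.

(* Generic parameters are indeterminates: an operator over parfield has
   coefficients that are rational functions of x and of the parameters, and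
   shifting a parameter is evaluating the family at a translated point. *)
Definition parfield : fieldType := {fraction {mpoly R[i][4]}}.

Definition param (i : 'I_4) : parfield := ('X_i : {mpoly R[i][4]})%:F.

End GenericPoint.

(* Main.v *)
(* With z = 4x(1-x) and T = z d/dz = x(1-x)/(1-2x) d/dx, the operator
   E3a(e1, e2, e5, e6) is (1-2x)/(x(1-x)) times the operator
     H = T(T-e1)(T-e2) - z(T+a1)(T+a2)(T+a3),  (a1, a2, a3) = (e5, e6, e7)/2,
   that is, the pullback of a generalized hypergeometric equation 3F2.  As
   e7 = 3-2e1-2e2-e5-e6, the shifts of e1 and e5 are the shifts (e1+1, a3-1),
   (e1-1, a3+1), (a1+1, a3-1), (a1-1, a3+1) of H.  Each comes from composing
   two contiguity relations, such as
     H(a1+1)(T+a1) = (T+a1)H(a1)  and  H(e1+1)(T-e1) = (T-e1-1)H(e1)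
   or the inverses of these modulo H; the composite has order three, and a
   multiple of H is subtracted from it to reach order two. *)

Require Import Defs.
From mathcomp Require Import all_boot all_order all_algebra.
From mathcomp Require Import reals complex mpoly ring.
Set Implicit Arguments.
Unset Strict Implicit.
Unset Printing Implicit Defensive.
Import GRing.Theory.
Local Open Scope ring_scope.

(** * Contiguity of [hyp], from the commutation rules of [T] with constants and with [z] *)

Section Hypergeometric.
Variables (K F : fieldType) (c : {rmorphism K -> F}).
Variables (T : F -> F) (z : F).
Hypothesis TD : {morph T : f g / f + g}.
Hypothesis TcM : forall a f, T (c a * f) = c a * T f.
Hypothesis TzM : forall f, T (z * f) = z * (T f + f).
Implicit Types (e a b : K) (f : F).

Lemma TN f : T (- f) = - T f.
Proof. by rewrite -mulN1r -(rmorph1 c) -rmorphN TcM rmorphN1 mulN1r. Qed.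

Definition quadratic (u : F * F * F) f :=
  u.1.1 * T (T f) + u.1.2 * T f + u.2 * f.

(** The condition on the leading coefficient is what later makes the shift operator nonzero. *)
Definition intertwined (A B : F -> F) :=
  exists u v : F * F * F,
    u.1.1 != 0 /\ forall f, B (quadratic u f) = quadratic v (A f).

Definition shifted a f := T f + c a * f.

Definition hyp e1 e2 a1 a2 a3 f :=
  shifted (- e1) (shifted (- e2) (T f))
  - z * shifted a1 (shifted a2 (shifted a3 f)).

Lemma hyp_swap e1 e2 a1 a2 a3 f : hyp e1 e2 a1 a2 a3 f = hyp e1 e2 a3 a2 a1 f.
Proof. by rewrite /hyp /shifted !(TD, TcM); ring. Qed.

(** Let M and r be the quotient and remainder of T(T-e1)(T-e2) by T+a3-1. Then L = z(T+a1)(T+a2) - M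
    satisfies H(a3-1)L = L H(a3), and (T-e1)L + H is (1-e1-a3) times [P e1]; the scalar is divided
    out. *)
Lemma hyp_raise_e e1 e2 a1 a2 a3 f :
  let P d f := z * shifted a1 (shifted a2 f)
    - shifted (- d) (shifted (1 - a3 - e2) f) in
  hyp (e1 + 1) e2 a1 a2 (a3 - 1) (P e1 f) = P (e1 + 1) (hyp e1 e2 a1 a2 a3 f).
Proof.
rewrite /= /hyp /shifted.
rewrite !(TD, TN, TcM, TzM).
ring.
Qed.

(** [M] is the quotient of T(T-e1)(T-e2) by T+a3-1, and the last constant in [P] is the remainder.
    With L = z(T+a1)(T+a2) - M, which lowers [a3], [P a1] is (T+a1)L + H. *)
Lemma hyp_raise_a e1 e2 a1 a2 a3 f :
  let M f := T (T f) + c (1 - e1 - e2 - a3) * T f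
             + c ((1 - a3 - e1) * (1 - a3 - e2)) * f in
  let P d f := c (a1 + 1 - a3) * (z * shifted d (shifted a2 f) - M f)
               + c ((1 - a3) * (1 - a3 - e1) * (1 - a3 - e2)) * f in
  hyp e1 e2 (a1 + 1) a2 (a3 - 1) (P a1 f) = P (a1 + 1) (hyp e1 e2 a1 a2 a3 f).
Proof.
rewrite /= /hyp /shifted.
rewrite !(TD, TN, TcM, TzM).
ring.
Qed.

Hypothesis z0 : z != 0.

Lemma TzVM f : T (z^-1 * f) = z^-1 * (T f - f).
Proof.
apply: (mulfI z0); rewrite mulVKf //.
by apply: (addIr f); rewrite subrK -{2}(mulVKf z0 f) -mulrDr -TzM mulVKf.
Qed.

(** Now (T+a1)(T+a2)(T+a3) is divided by T+1-e1, with quotient N. Then L = z^-1 T(T-e2) - N lowers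
    [e1], and (T+a3)L - z^-1 H is (e1+a3-1) times [P a3]. Normalizing H by z^-1 gives the left
    factor the same form [P]. *)
Lemma hyp_lower_e e1 e2 a1 a2 a3 f :
  let P d f := z^-1 * shifted (- e2) (T f)
    - shifted d (shifted (a1 + a2 + e1 - 1) f) in
  z^-1 * hyp (e1 - 1) e2 a1 a2 (a3 + 1) (P a3 f) =
  P (a3 + 1) (z^-1 * hyp e1 e2 a1 a2 a3 f).
Proof.
rewrite /= /hyp /shifted.
rewrite !(TD, TN, TcM, TzM, TzVM).
by field.
Qed.

Hypothesis z1 : z != 1.

Let subz1_neq0 : z - 1 != 0. Proof. by rewrite subr_eq0. Qed.

Lemma intertwined_raise_e e1 e2 a1 a2 a3 :
  intertwined (hyp e1 e2 a1 a2 a3) (hyp (e1 + 1) e2 a1 a2 (a3 - 1)).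
Proof.
pose u d : F * F * F :=
  (z - 1, c (a1 + a2) * z - c (1 - a3 - e2 - d),
   c (a1 * a2) * z + c (d * (1 - a3 - e2))).
exists (u e1), (u (e1 + 1)); split=> //= f.
have uE d g : quadratic (u d) g = z * shifted a1 (shifted a2 g)
    - shifted (- d) (shifted (1 - a3 - e2) g).
  by rewrite /quadratic /shifted /= !(TD, TcM); ring.
by rewrite !uE hyp_raise_e.
Qed.

(** For [a3 = a1 + 1] the shift merely exchanges [a1] and [a3], and the quadratic operator below
    degenerates to a constant. *)
Lemma intertwined_raise_a e1 e2 a1 a2 a3 : a1 + 1 - a3 != 0 ->
  intertwined (hyp e1 e2 a1 a2 a3) (hyp e1 e2 (a1 + 1) a2 (a3 - 1)).
Proof.
move=> d0; set d := a1 + 1 - a3 in d0.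
pose u b : F * F * F :=
  (c d * (z - 1), c d * (c (b + a2) * z - c (1 - e1 - e2 - a3)),
   c d * (c (b * a2) * z - c ((1 - a3 - e1) * (1 - a3 - e2)))
   + c ((1 - a3) * (1 - a3 - e1) * (1 - a3 - e2))).
exists (u a1), (u (a1 + 1)); split=> [|f] /=.
  by rewrite mulf_neq0 // fmorph_eq0.
have uE b g : quadratic (u b) g = c d * (z * shifted b (shifted a2 g)
    - (T (T g) + c (1 - e1 - e2 - a3) * T g
       + c ((1 - a3 - e1) * (1 - a3 - e2)) * g))
    + c ((1 - a3) * (1 - a3 - e1) * (1 - a3 - e2)) * g.
  by rewrite /quadratic /shifted /= !(TD, TcM); ring.
by rewrite !uE hyp_raise_a.
Qed.

Lemma intertwined_lower_e e1 e2 a1 a2 a3 :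
  intertwined (fun f => z^-1 * hyp e1 e2 a1 a2 a3 f)
              (fun f => z^-1 * hyp (e1 - 1) e2 a1 a2 (a3 + 1) f).
Proof.
pose k := a1 + a2 + e1 - 1.
pose u d : F * F * F :=
  (z^-1 - 1, - c e2 * z^-1 - c (d + k), - c (d * k)).
exists (u a3), (u (a3 + 1)); split=> [|f] /=.
  by rewrite subr_eq0 invr_eq1.
have uE d g : quadratic (u d) g = z^-1 * shifted (- e2) (T g)
    - shifted d (shifted k g).
  by rewrite /quadratic /shifted /= !(TD, TcM); ring.
by rewrite !uE hyp_lower_e.
Qed.

End Hypergeometric.

(** * The substitution z = 4x(1-x) *)

Section Pullback.
Variables (K F : fieldType) (c : {rmorphism K -> F}) (D : F -> F) (x : F).
Hypothesis DD : {morph D : f g / f + g}.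
Hypothesis DM : forall f g, D (f * g) = D f * g + f * D g.
Hypothesis Dc : forall a, D (c a) = 0.
Hypothesis Dx : D x = 1.
Hypothesis x0 : x != 0.
Hypothesis x1 : 1 - x != 0.
Hypothesis x2 : 1 - 2 * x != 0.
Hypothesis F2 : (2 : K) != 0.
Implicit Types (e a : K) (f g : F).

Let z := 4 * x * (1 - x).
Let w := x * (1 - x) / (1 - 2 * x).
Definition euler f := w * D f.

Let DcM a f : D (c a * f) = c a * D f.
Proof. by rewrite DM Dc mul0r add0r. Qed.

Let DN f : D (- f) = - D f.
Proof. by rewrite -mulN1r -(rmorph1 c) -rmorphN DcM rmorphN1 mulN1r. Qed.

Let Dnat n : D n%:R = 0. Proof. by rewrite -(rmorph_nat c) Dc. Qed.

Let DX2 : D (1 - 2 * x) = - 2.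
Proof. by rewrite !(DD, DN, DM, Dx, Dnat) (Dnat 1); ring. Qed.

Let Dw : D w = 1 + 2 * w / (1 - 2 * x).
Proof.
apply: (mulIf x2); have : D (w * (1 - 2 * x)) = D (x * (1 - x)).
  by rewrite /w mulfVK.
rewrite DM DX2 => /(canRL (addrK _)) ->.
by rewrite !(DM, DD, DN, Dx) (Dnat 1) /w; field.
Qed.

Let DDw : D (D w) = 2 * D w / (1 - 2 * x) + 4 * w / (1 - 2 * x) ^+ 2.
Proof.
apply: (mulIf x2).
have : D (D w * (1 - 2 * x)) = D (1 - 2 * x + 2 * w).
  by rewrite Dw; congr D; field.
rewrite DM DX2 DD DX2 (DM 2) Dnat => /(canRL (addrK _)) ->.
by rewrite Dw; field.
Qed.

Lemma eulerD : {morph euler : f g / f + g}.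
Proof. by move=> f g; rewrite /euler DD mulrDr. Qed.

Lemma euler_cM a f : euler (c a * f) = c a * euler f.
Proof. by rewrite /euler DcM mulrCA. Qed.

(** [w] is chosen so that w z' = z, where z' = 4(1-2x). *)
Lemma euler_zM f : euler (z * f) = z * (euler f + f).
Proof.
rewrite /euler /z !(DM, DD, DN, Dx, Dnat) (Dnat 1) /w; field.
exact: x2.
Qed.

(** The left side is [E3a] with e5, e6, e7 = 2a1, 2a2, 2a3; the hypothesis is e1 + ... + e7 = 3. *)
Lemma E3_coeff_hyp e1 e2 a1 a2 a3 f :
  2 * (e1 + e2 + a1 + a2 + a3) = 3 ->
    x ^+ 2 * (x - 1) ^+ 2 * D (D (D f))
  + x * (x - 1) * (c (6 - 2 * e1 - 2 * e2) * x + c (- 3 + e1 + e2)) * D (D f)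
  + (c ((2 * a1 + 2 * a2 + 1) * (2 * a3) + (2 * a2 + 1) * (2 * a1 + 1))
       * x ^+ 2
     + c (- (2 * a1 + 2 * a2) * (2 * a3) - 4 * a1 * a2 + 2 * e1 + 2 * e2 - 4)
         * x
     + c ((e1 - 1) * (e2 - 1))) * D f
  + (c (8 * a1 * a2 * a3) * x - c (4 * a1 * a2 * a3)) * f
  = w^-1 * hyp c euler z e1 e2 a1 a2 a3 f.
Proof.
move=> sum3.
have {sum3} -> : e2 = 3 / 2 - e1 - a1 - a2 - a3 by rewrite -sum3; field.
have F2' : (2 : F) != 0 by rewrite -(rmorph_nat c) fmorph_eq0.
rewrite /hyp /shifted !(eulerD, euler_cM) /euler.
(* [w] becomes opaque so that its derivatives are rewritten by [dw] and [ddw]; its value returns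
   only at the end, through [wE]. *)
have := erefl w; rewrite {2}/w; move: Dw DDw; clearbody w => dw ddw wE.
rewrite !(DM, DD) ddw dw wE /z.
by field; rewrite x2 F2' x1 x0.
Qed.
End Pullback.

(** * Operators in characteristic 0, determined by their action on K(x) *)

Section Faithful.
Variable K : fieldType.
Hypothesis charK : [pchar K] =i pred0.
Implicit Types (P Q : diffop K) (f : ratfun K).

Lemma iter_fderiv_tofrac n (p : {poly K}) :
  iter n (@fderiv K) p%:F = (p^`(n))%:F.
Proof. by elim: n => //= n ->; rewrite fderiv_tofrac. Qed.

(** An operator whose coefficients below i vanish sends x^i to i! times its i-th coefficient. *)
Lemma dapply_eq0 P : (forall f, dapply P f = 0) -> P = 0.
Proof.
move=> P0; apply/polyP => i; rewrite coef0.
elim/ltn_ind: i => i IH.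
(* The bound [maxn] keeps index [i] in the sum even when [i] exceeds the degree of [P]. *)
have := P0 ('X^i)%:F; rewrite (@dapplyE _ (maxn (size P) i.+1)) ?leq_maxl //.
have lti : (i < maxn (size P) i.+1)%N by rewrite leq_maxr.
rewrite (bigD1 (Ordinal lti)) //= big1 ?addr0 => [|j neq_ji].
  rewrite iter_fderiv_tofrac derivnXn ffactnn subnn expr0 => /eqP.
  rewrite mulf_eq0 tofrac_eq0 -polyC1 -polyCMn polyC_eq0 orbC.
  by rewrite (pcharf0P K).1 // -leqn0 leqNgt fact_gt0 => /eqP.
case: (ltngtP j i) neq_ji => [/IH->|lt_ij _|eq_ji /eqP[]].
- by rewrite mul0r.
- by rewrite iter_fderiv_tofrac derivnXn ffact_small // tofrac0 mulr0.
- exact: val_inj.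
Qed.

Lemma dapply_inj P Q : (forall f, dapply P f = dapply Q f) -> P = Q.
Proof.
move=> eqPQ; apply/subr0_eq/dapply_eq0 => f.
by rewrite dapplyD -scaleN1r dapplyZ mulN1r eqPQ subrr.
Qed.

Lemma dapplyC a f : dapply (a%:P : diffop K) f = a * f.
Proof. by rewrite (dapplyE _ (size_polyC_leq1 _)) big_ord1 coefC. Qed.

Lemma dapplyXn n f : dapply (partial ^+ n : diffop K) f = iter n (@fderiv K) f.
Proof.
rewrite (@dapplyE _ n.+1) ?size_polyXn // big_ord_recr /= big1 => [|i _].
  by rewrite coefXn eqxx mul1r add0r.
by rewrite coefXn ltn_eqF // mul0r.
Qed.

Section FirstOrder.
Variable w : ratfun K.
Hypothesis w_neq0 : w != 0.
Let T f := w * fderiv f.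

(** The coefficients follow from (w d/dx)^2 = w^2 (d/dx)^2 + w w' d/dx. *)
Definition quadratic_op (u : ratfun K * ratfun K * ratfun K) : diffop K :=
  Poly [:: u.2; u.1.1 * w * fderiv w + u.1.2 * w; u.1.1 * w ^+ 2].

Lemma size_quadratic_op u : (size (quadratic_op u) <= 3)%N.
Proof. exact: size_Poly. Qed.

Lemma quadratic_op_neq0 u : u.1.1 != 0 -> quadratic_op u != 0.
Proof.
move=> u20; apply: contraNneq (mulf_neq0 u20 (expf_neq0 2 w_neq0)) => t0.
have := congr1 (fun p : diffop K => p`_2) t0.
by rewrite coef_Poly coef0 /= => ->.
Qed.

Lemma dapply_quadratic_op u f : dapply (quadratic_op u) f = quadratic T u f.
Proof.
rewrite (dapplyE _ (size_quadratic_op _)) !big_ord_recl big_ord0 !coef_Poly /=.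
by rewrite /quadratic /T fderivM; ring.
Qed.

Lemma intertwined_shift E Eplus k A B :
    k != 0 -> (forall f, dapply E f = k * A f) ->
    (forall f, dapply Eplus f = k * B f) ->
  intertwined T A B -> has_shift_operator E Eplus.
Proof.
move=> k0 EA EB [u [v [u0 BA]]]; exists (quadratic_op u).
split; [exact: quadratic_op_neq0 | exact: size_quadratic_op |].
(* Since [E] is k A and [Eplus] is k B, the left factor has to be k v k^-1. *)
exists (dcomp (k *: quadratic_op v) (k^-1)%:P).
apply: dapply_inj => f.
rewrite 3!dapply_dcomp dapplyZ dapplyC EA EB (mulKf k0) 2!dapply_quadratic_op.
by rewrite BA.
Qed.

End FirstOrder.
End Faithful.

(** * Shift operators of [E3a] under explicit nondegeneracy conditions *)

Section QuadraticPullback.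
Variable K : fieldType.
Hypothesis charK : [pchar K] =i pred0.
Implicit Types (e a : K) (f : ratfun K).

Let cst : {rmorphism K -> ratfun K} := @tofrac _ \o polyC.
Let x : ratfun K := 'X%:F.

Lemma dapply_E3 e1 e2 e3 e4 e5 e6 e7 f :
  dapply (E3 e1 e2 e3 e4 e5 e6 e7) f =
    x ^+ 2 * (x - 1) ^+ 2 * fderiv (fderiv (fderiv f))
  + x * (x - 1) * (cst (6 - e1 - e2 - e3 - e4) * x + cst (- 3 + e1 + e2))
      * fderiv (fderiv f)
  + (cst ((e5 + e6 + 1) * e7 + (e6 + 1) * (e5 + 1)) * x ^+ 2
     + cst (- (e5 + e6) * e7 - e1 * e2 + e3 * e4 - e5 * e6
             + 2 * e1 + 2 * e2 - 4) * x + cst ((e1 - 1) * (e2 - 1)))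
      * fderiv f
  + (cst (e5 * e6 * e7) * x + cst (A00 e1 e2 e3 e4 e5 e6 e7)) * f.
Proof.
rewrite /E3; cbv zeta; rewrite !dapplyD !dapplyZ dapplyC 2!dapplyXn.
rewrite (dapplyXn 1%N) /=.
by rewrite !(tofracM, tofracD, tofracXn, tofracN, tofrac1).
Qed.

Lemma natr_neq0 n : n.+1%:R != 0 :> K.
Proof. by rewrite (pcharf0P K).1. Qed.

Lemma x_neq0 : x != 0.
Proof. by rewrite tofrac_eq0 polyX_eq0. Qed.

Lemma affine_neq0 a e : e != 0 -> cst a - cst e * x != 0.
Proof.
move=> e0; rewrite -tofracM -tofracN -tofracD tofrac_eq0.
apply/eqP => /(congr1 (fun p : {poly K} => p`_1)) /eqP.
by rewrite coefB coefC coefCM coefX mulr1 coef0 sub0r oppr_eq0 (negPf e0).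
Qed.

Lemma subx_neq0 : 1 - x != 0.
Proof. by have := affine_neq0 1 (oner_neq0 K); rewrite rmorph1 mul1r. Qed.

Lemma sub2x_neq0 : 1 - 2 * x != 0.
Proof. by have := affine_neq0 1 (natr_neq0 1); rewrite rmorph1 rmorph_nat. Qed.

Let z := 4 * x * (1 - x).
Let w := x * (1 - x) / (1 - 2 * x).
Let T := euler (@fderiv K) x.

Lemma w_neq0 : w != 0.
Proof.
apply: mulf_neq0; first exact: mulf_neq0 x_neq0 subx_neq0.
by rewrite invr_eq0 sub2x_neq0.
Qed.

Lemma z_neq0 : z != 0.
Proof.
apply: mulf_neq0 subx_neq0; apply: mulf_neq0 x_neq0.
by rewrite -(rmorph_nat cst) fmorph_eq0 natr_neq0.
Qed.

Lemma z_neq1 : z != 1.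
Proof.
rewrite -subr_eq0 (_ : z - 1 = - (1 - 2 * x) ^+ 2); last by rewrite /z; ring.
by rewrite oppr_eq0 expf_neq0 ?sub2x_neq0.
Qed.

Let fderiv_cst a : fderiv (cst a) = 0.
Proof. by rewrite fderiv_tofrac derivC tofrac0. Qed.

Let fderiv_x : fderiv x = 1.
Proof. by rewrite fderiv_tofrac derivX tofrac1. Qed.

Let TD := eulerD x (@fderivD K).
Let TcM := euler_cM x (@fderivM K) fderiv_cst.
Let TzM := euler_zM (@fderivD K) (@fderivM K) fderiv_cst fderiv_x sub2x_neq0.

Definition half_e7 e1 e2 e5 e6 := (3 - 2 * e1 - 2 * e2 - e5 - e6) / 2.

Lemma dapply_E3a e1 e2 e5 e6 f :
  dapply (E3a e1 e2 e5 e6) f =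
  w^-1 * hyp cst T z e1 e2 (e5 / 2) (e6 / 2) (half_e7 e1 e2 e5 e6) f.
Proof.
have K2 := natr_neq0 1.
rewrite -(E3_coeff_hyp (@fderivD K) (@fderivM K) fderiv_cst fderiv_x
  x_neq0 subx_neq0 sub2x_neq0 K2); last by rewrite /half_e7; field.
rewrite /E3a dapply_E3; congr (_ + _ * (cst _ * _ + cst _) * _
  + (cst _ * _ + cst _ * _ + cst _) * _ + (cst _ * _ + _) * _).
- by ring.
- by rewrite /half_e7; field.
- by rewrite /half_e7; field.
- by rewrite /half_e7; field.
(* With e3 = e1 and e4 = e2, all terms of [A00] cancel except -27 e5 e6 e7 / 54. *)
rewrite -rmorphN; congr (cst _); rewrite /A00 /half_e7.
by field; rewrite K2 natr_neq0.
Qed.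

(** Together with [E3aC56], this reduces shifts of e2 and e6 to those of e1 and e5. *)
Lemma E3aC12 e1 e2 e5 e6 : E3a e1 e2 e5 e6 = E3a e2 e1 e5 e6.
Proof.
rewrite /E3a /E3 /A00 /=; congr (_ + (_ * (_%:P * _ + _%:P))%:F *: _
  + (_%:P * _ + _%:P * _ + _%:P)%:F *: _ + ((_%:P * _ + _%:P)%:F)%:P); ring.
Qed.

Lemma E3aC56 e1 e2 e5 e6 : E3a e1 e2 e5 e6 = E3a e1 e2 e6 e5.
Proof.
rewrite /E3a /E3 /A00 /=; congr (_ + _
  + (_%:P * _ + _%:P * _ + _%:P)%:F *: _ + ((_%:P * _ + _%:P)%:F)%:P); ring.
Qed.

Lemma E3a_raise_e1 e1 e2 e5 e6 :
  has_shift_operator (E3a e1 e2 e5 e6) (E3a (e1 + 1) e2 e5 e6).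
Proof.
have [K2 w'0] := (natr_neq0 1, invr_neq0 w_neq0).
apply: (intertwined_shift charK w_neq0 w'0 (dapply_E3a _ _ _ _)
         (dapply_E3a _ _ _ _)).
have -> : half_e7 (e1 + 1) e2 e5 e6 = half_e7 e1 e2 e5 e6 - 1.
  by rewrite /half_e7; field.
exact: intertwined_raise_e TD TcM TzM z_neq1 _ _ _ _ _.
Qed.

Lemma E3a_lower_e1 e1 e2 e5 e6 :
  has_shift_operator (E3a e1 e2 e5 e6) (E3a (e1 - 1) e2 e5 e6).
Proof.
have [K2 wz0] := (natr_neq0 1, mulf_neq0 (invr_neq0 w_neq0) z_neq0).
(* The prefactor is split as w^-1 z times z^-1 to match the normalization in
   [intertwined_lower_e]. *)
have E3aE d e b b' f : dapply (E3a d e b b') f =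
    w^-1 * z * (z^-1 * hyp cst T z d e (b / 2) (b' / 2) (half_e7 d e b b') f).
  by rewrite dapply_E3a -mulrA (mulVKf z_neq0).
apply: (intertwined_shift charK w_neq0 wz0 (E3aE _ _ _ _) (E3aE _ _ _ _)).
have -> : half_e7 (e1 - 1) e2 e5 e6 = half_e7 e1 e2 e5 e6 + 1.
  by rewrite /half_e7; field.
exact: intertwined_lower_e TD TcM TzM z_neq0 z_neq1 _ _ _ _ _.
Qed.

(** The hypothesis is the condition a1 + 1 - a3 != 0 of [intertwined_raise_a], doubled. *)
Lemma E3a_raise_e5 e1 e2 e5 e6 : 2 * e1 + 2 * e2 + 2 * e5 + e6 != 1 ->
  has_shift_operator (E3a e1 e2 e5 e6) (E3a e1 e2 (e5 + 2) e6).
Proof.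
move=> gen; have [K2 w'0] := (natr_neq0 1, invr_neq0 w_neq0).
apply: (intertwined_shift charK w_neq0 w'0 (dapply_E3a _ _ _ _)
         (dapply_E3a _ _ _ _)).
have -> : half_e7 e1 e2 (e5 + 2) e6 = half_e7 e1 e2 e5 e6 - 1.
  by rewrite /half_e7; field.
have -> : (e5 + 2) / 2 = e5 / 2 + 1 by field.
apply: (intertwined_raise_a TD TcM TzM z_neq1).
rewrite (_ : _ - _ = (2 * e1 + 2 * e2 + 2 * e5 + e6 - 1) / 2); last first.
  by rewrite /half_e7; field.
by rewrite mulf_neq0 ?invr_neq0 // subr_eq0.
Qed.

(** Lowering a1 while raising a3 is [intertwined_raise_a] with a1 and a3 exchanged, so the condition
    becomes a3 + 1 - a1 != 0. *)
Lemma E3a_lower_e5 e1 e2 e5 e6 : 2 * e1 + 2 * e2 + 2 * e5 + e6 != 5 ->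
  has_shift_operator (E3a e1 e2 e5 e6) (E3a e1 e2 (e5 - 2) e6).
Proof.
move=> gen; have [K2 w'0] := (natr_neq0 1, invr_neq0 w_neq0).
have E3aE b f : dapply (E3a e1 e2 b e6) f =
    w^-1 * hyp cst T z e1 e2 (half_e7 e1 e2 b e6) (e6 / 2) (b / 2) f.
  by rewrite dapply_E3a (hyp_swap z TD TcM).
apply: (intertwined_shift charK w_neq0 w'0 (E3aE _) (E3aE _)).
have -> : half_e7 e1 e2 (e5 - 2) e6 = half_e7 e1 e2 e5 e6 + 1.
  by rewrite /half_e7; field.
have -> : (e5 - 2) / 2 = e5 / 2 - 1 by field.
apply: (intertwined_raise_a TD TcM TzM z_neq1).
rewrite (_ : _ - _ = - (2 * e1 + 2 * e2 + 2 * e5 + e6 - 5) / 2); last first.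
  by rewrite /half_e7; field.
by rewrite mulf_neq0 ?invr_neq0 ?oppr_eq0 // subr_eq0.
Qed.

End QuadraticPullback.

(** * Nondegeneracy for indeterminate parameters *)

Section Generic.
Variable R : realType.

Lemma parfield_pchar : [pchar parfield R] =i pred0.
Proof.
pose c : {rmorphism R[i] -> parfield R} := @tofrac _ \o @mpolyC 4 R[i].
by move=> p; rewrite (fmorph_pchar c) Num.Theory.pchar_num.
Qed.

(** Setting all indeterminates to 0 separates the two sides. *)
Lemma param_neq (i j k l : 'I_4) n :
  2 * param R i + 2 * param R j + 2 * param R k + param R l != n.+1%:R.
Proof.
rewrite eq_sym -subr_eq0 /param -(rmorph_nat (@tofrac _)).
rewrite (_ : 2 = (2%:R : {mpoly R[i][4]})%:F); last by rewrite rmorph_nat.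
rewrite -!tofracM -!tofracD -tofracB tofrac_eq0.
apply/eqP => /(congr1 (meval (fun=> 0))) /eqP.
rewrite rmorphB !rmorphD !rmorphM !rmorph_nat /= !mevalXU !mulr0 !addr0 subr0.
by rewrite rmorph0 Num.Theory.pnatr_eq0.
Qed.

End Generic.

Theorem theorem5p1 (R : realType) :
  let e1 := param R 0 in
  let e2 := param R 1 in
  let e5 := param R 2 in
  let e6 := param R 3 in
  [/\ has_shift_operator (E3a e1 e2 e5 e6) (E3a (e1 + 1) e2 e5 e6) /\
      has_shift_operator (E3a e1 e2 e5 e6) (E3a (e1 - 1) e2 e5 e6),
      has_shift_operator (E3a e1 e2 e5 e6) (E3a e1 (e2 + 1) e5 e6) /\
      has_shift_operator (E3a e1 e2 e5 e6) (E3a e1 (e2 - 1) e5 e6),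
      has_shift_operator (E3a e1 e2 e5 e6) (E3a e1 e2 (e5 + 2) e6) /\
      has_shift_operator (E3a e1 e2 e5 e6) (E3a e1 e2 (e5 - 2) e6)
    & has_shift_operator (E3a e1 e2 e5 e6) (E3a e1 e2 e5 (e6 + 2)) /\
      has_shift_operator (E3a e1 e2 e5 e6) (E3a e1 e2 e5 (e6 - 2))].
Proof.
move=> e1 e2 e5 e6; have char0 := parfield_pchar R.
split; split.
- exact: E3a_raise_e1.
- exact: E3a_lower_e1.
- by rewrite E3aC12 (E3aC12 e1); apply: E3a_raise_e1.
- by rewrite E3aC12 (E3aC12 e1); apply: E3a_lower_e1.
(* The last argument of [param_neq] is one less than the excluded value: 0 for 1, and 4 for 5
   below. *)
- exact: (E3a_raise_e5 char0 (@param_neq R 0 1 2 3 0)).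
- exact: (E3a_lower_e5 char0 (@param_neq R 0 1 2 3 4)).
- rewrite 2!(E3aC56 _ _ e5).
  exact: (E3a_raise_e5 char0 (@param_neq R 0 1 3 2 0)).
- rewrite 2!(E3aC56 _ _ e5).
  exact: (E3a_lower_e5 char0 (@param_neq R 0 1 3 2 4)).
Qed.
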